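(* For any sum-distinct set $\{a_1,\ldots,a_n\}$ of integers with $0<a_1<a_2<\cdots<a_n$, the inequality $$a_n>\sigma_n\,2^{n-1}$$ holds.
   Context: A finite set $\{a_1,\ldots,a_n\}$ of $n$ integers is called sum-distinct if any two of its $2^n$ subsums differ by at least $1$, i.e. for any two distinct subsets $I,J\subseteq\{1,\ldots,n\}$ one has $\sum_{i\in I}a_i\neq\sum_{j\in J}a_j$ (the empty sum being $0$). The constant $\sigma_n$ is the sinc integral $$\sigma_n=\frac{2}{\pi}\int_0^\infty\left(\frac{\sin t}{t}\right)^n dt.$$
   Formalization: The formal theorem assumes n ≥ 3; the strict inequality as stated fails for n = 1 with {1} (σ_1 = 1, 1 > 1) and for n = 2 with {1,2} (σ_2 = 1, 2 > 2). *)

(* Defs.v *)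
From HB Require Import structures.
From mathcomp Require Import all_boot all_order all_algebra.
From mathcomp Require Import all_classical all_reals all_analysis.
Set Implicit Arguments.
Unset Strict Implicit.
Unset Printing Implicit Defensive.
Import Order.TTheory GRing.Theory Num.Theory.
Import numFieldNormedType.Exports.
Local Open Scope classical_set_scope.
Local Open Scope ring_scope.

(** The a i need not be pairwise distinct a priori: this is forced by taking
    I and J to be singletons. *)
Definition sum_distinct (n : nat) (a : 'I_n -> int) : Prop :=
  forall I J : {set 'I_n}, I != J -> \sum_(i in I) a i <> \sum_(j in J) a j.

(** The integral over [0, +oo[ is an improper one, as sin t / t is not
    Lebesgue integrable when n = 1. At t = 0 the integrand takes the junk value
    [0 ^+ n] (division by 0), which does not affect the integral. *)
Definition sinc_integral (R : realType) (n : nat) : R :=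
  2 / pi *
  lim ((\int[lebesgue_measure]_(t in `[0, b]) (sin t / t) ^+ n) @[b --> +oo]).

(* Main.v *)
Require Import Defs.
From HB Require Import structures.
From mathcomp Require Import all_boot all_order all_algebra.
From mathcomp Require Import all_classical all_reals all_analysis.
From mathcomp Require Import measurable_realfun ring lra.
Set Implicit Arguments.
Unset Strict Implicit.
Unset Printing Implicit Defensive.
Import Order.TTheory GRing.Theory Num.Theory.
Import numFieldNormedType.Exports.
Local Open Scope classical_set_scope.
Local Open Scope ring_scope.

(** Write N = n + 1, and a_1 < ... < a_N for the given integers. Let U_1, ..., U_N be
    independent random variables, uniform on [-1/2, 1/2], and let D be the density
    at 0 of s_1 U_1 + ... + s_N U_N, where s_i = a_i / a_N. Two bounds for D give the
    theorem: D <= a_N / 2^(N - 1), because the subset sums are distinct, and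
    D > sigma_N, because all weights are at most 1.

    Upper bound ([avgs_box_le]). By scaling, D / (2 a_N) is the density at 0 of the sum
    of the 2 a_i U_i. The law of 2 a_i U_i is the even mixture of the laws of
    a_i U_i + a_i / 2 and a_i U_i - a_i / 2. Hence this density is the mean, over all
    2^N choices of signs, of the values of the density K of the sum of the a_i U_i at
    the points (+- a_1 +- ... +- a_N) / 2. Up to a common shift these points are the
    subset sums, that is, 2^N distinct integers. But the translates of K by all
    integers add up to the constant 1, as a_i U_i is uniform modulo 1. So the mean is at
    most 1 / 2^N.

    Lower bound ([avgs_gt_nseq1]). If V has an even unimodal density f, then the density
    of s U + V is again even and unimodal, and its value at 0 is the mean of f over
    [- s / 2, s / 2], which does not increase with s. Therefore D does not increase when
    s_1, ..., s_(N-1) are replaced by 1, one after the other. The last replacement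
    decreases it strictly: there V is a sum of N - 1 >= 2 uniform variables and f is
    strictly decreasing on [0, 1/2].

    The density at 0 of U_1 + ... + U_N equals sigma_N ([sinc_integral_avgs]). For two
    summands, the density is the triangle function, and it differs from
    2 / pi times the integral of sinc^2 t cos (2 x t) over [0, b] by O(1/b), uniformly in
    x; this rests on the integral of sinc^2 alone, which is evaluated with the Fejer
    kernel. Each further summand averages over a window of width 1, and the average of
    cos (2 t y) over such a window centred at x is sinc t cos (2 t x), so that N - 2
    averages lead to the integral of sinc^N.

    No random variable occurs in the formal text: densities are functions, adding
    s U is the averaging operator [avg s], and the summand with the largest weight is
    represented by the function [box]. *)

(** * Bounded measurable functions *)

(** Continuity would be too strong a requirement here: all densities below are
    obtained from the indicator function of an interval. Boundedness gives
    integrability on bounded intervals. *)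
Definition bounded_measurable {R : realType} d (T : measurableType d)
    (f : T -> R) : Prop :=
  measurable_fun setT f /\ exists M : R, forall t, `|f t| <= M.

Section BoundedMeasurable.
Context {R : realType} d (T : measurableType d).
Implicit Types f g : T -> R.

Lemma bounded_measurable_cst (k : R) : bounded_measurable (fun _ : T => k).
Proof. by split; [exact: measurable_cst|exists `|k|]. Qed.

Lemma bounded_measurableD f g : bounded_measurable f -> bounded_measurable g ->
  bounded_measurable (fun t => f t + g t).
Proof.
move=> [mf [M fM]] [mg [N gN]]; split; first exact: measurable_funD.
by exists (M + N) => t; rewrite (le_trans (ler_normD _ _))// lerD.
Qed.

Lemma bounded_measurableM f g : bounded_measurable f -> bounded_measurable g ->
  bounded_measurable (fun t => f t * g t).
Proof.
move=> [mf [M fM]] [mg [N gN]]; split; first exact: measurable_funM.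
by exists (M * N) => t; rewrite normrM ler_pM.
Qed.

Lemma bounded_measurableZ (k : R) f : bounded_measurable f ->
  bounded_measurable (fun t => k * f t).
Proof. by apply: bounded_measurableM; exact: bounded_measurable_cst. Qed.

Lemma bounded_measurableB f g : bounded_measurable f -> bounded_measurable g ->
  bounded_measurable (fun t => f t - g t).
Proof.
move=> bf bg; rewrite (_ : (fun _ => _) = fun t => f t + (-1) * g t).
  by apply: bounded_measurableD => //; exact: bounded_measurableZ.
by apply/funext => t; rewrite mulN1r.
Qed.

Lemma bounded_measurableX f n : bounded_measurable f ->
  bounded_measurable (fun t => f t ^+ n).
Proof.
move=> bf; elim: n => [|n ih].
  rewrite (_ : (fun _ => _) = fun=> 1); first exact: bounded_measurable_cst.
  by apply/funext => t; rewrite expr0.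
rewrite (_ : (fun _ => _) = fun t => f t * f t ^+ n).
  exact: bounded_measurableM.
by apply/funext => t; rewrite exprS.
Qed.

Lemma bounded_measurable_comp d' (T' : measurableType d') (h : T' -> T) f :
  measurable_fun setT h -> bounded_measurable f ->
  bounded_measurable (fun t => f (h t)).
Proof.
move=> mh [mf [M fM]]; split; first exact: measurableT_comp.
by exists M => t; exact: fM.
Qed.

Lemma bounded_measurable_integrable (mu : {measure set T -> \bar R}) f (D : set T) :
  bounded_measurable f -> measurable D -> (mu D < +oo)%E ->
  mu.-integrable D (EFin \o f).
Proof.
move=> [mf [M fM]] mD Dfin; apply: measurable_bounded_integrable => //.
  exact: measurable_funTS.
exists M; split; first exact: num_real.
by move=> x Mx t _; exact: le_trans (fM t) (ltW Mx).
Qed.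

End BoundedMeasurable.

(** * Integrals over bounded intervals *)

(** Half-open intervals concatenate without overlap, and they keep the point 0,
    where [sin t / t] takes a junk value, out of the integrals over [0, b]. *)
Definition oc_integral {R : realType} (a b : R) (f : R -> R) : R :=
  \int[lebesgue_measure]_(t in `]a, b]) f t.

Section IntegralOnIntervals.
Context {R : realType}.
Notation mu := (@lebesgue_measure R).
Implicit Types (f g : R -> R) (a b c s t u x y : R).

Lemma measurable_affine c s : measurable_fun setT (fun u : R => c + s * u).
Proof. by apply: measurable_funD => //; exact: measurable_funM. Qed.

Lemma bounded_measurable_affine f c s : bounded_measurable f ->
  bounded_measurable (fun u => f (c + s * u)).
Proof. by apply: bounded_measurable_comp; exact: measurable_affine. Qed.

Lemma bounded_measurable_shift f c : bounded_measurable f ->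
  bounded_measurable (fun u => f (u + c)).
Proof.
move=> bf; rewrite (_ : (fun _ => _) = fun u => f (c + 1 * u)).
  exact: bounded_measurable_affine.
by apply/funext => u; rewrite mul1r addrC.
Qed.

Lemma itv_measure_lty (ba bb : bool) a b :
  (mu ([set` Interval (BSide ba a) (BSide bb b)] : set R) < +oo)%E.
Proof. by rewrite lebesgue_measure_itv/=; case: ifP => _; rewrite -?EFinB ltry. Qed.

Lemma bounded_measurable_oc f a b : bounded_measurable f ->
  mu.-integrable `]a, b] (EFin \o f).
Proof.
move=> bf; apply: bounded_measurable_integrable => //; exact: itv_measure_lty.
Qed.
Hint Resolve bounded_measurable_oc : core.

(** Both sides are measures in [A], so it is enough to compare them on half-open
    intervals. *)
Lemma lebesgue_measure_affine c s (A : set R) : 0 < s -> measurable A ->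
  (mu A = s%:E * mu ((fun u => c + s * u)%R @^-1` A))%E.
Proof.
move=> s0 mA; pose phi := (fun u : R => (c + s * u)%R) : R -> measurableTypeR R.
have mphi : measurable_fun setT phi by exact: measurable_affine.
pose nu := mscale (NngNum (ltW s0)) (pushforward mu phi) : {measure set _ -> \bar R}.
transitivity (nu mphi A); last by [].
apply: lebesgue_measure_unique => // _ [[a b]] _ <-.
transitivity (s%:E * mu (phi @^-1` `]a, b]))%E; last by [].
rewrite (_ : phi @^-1` _ = `](a - c) / s, (b - c) / s]%classic); last first.
  by apply/seteqP; split=> x /=; rewrite !in_itv/= /phi ltr_pdivrMr// ler_pdivlMr//; lra.
rewrite !lebesgue_measure_itv/= !lte_fin ltr_pM2r ?invr_gt0// ltrD2r.
case: ifPn => _; rewrite ?mule0// -!EFinB -EFinM; congr EFin; field; lra.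
Qed.

Lemma oc_integralD f g a b : bounded_measurable f -> bounded_measurable g ->
  oc_integral a b (fun t => f t + g t) = oc_integral a b f + oc_integral a b g.
Proof. by move=> bf bg; rewrite /oc_integral RintegralD//; exact: bounded_measurable_oc. Qed.

Lemma oc_integralB f g a b : bounded_measurable f -> bounded_measurable g ->
  oc_integral a b (fun t => f t - g t) = oc_integral a b f - oc_integral a b g.
Proof. by move=> bf bg; rewrite /oc_integral RintegralB//; exact: bounded_measurable_oc. Qed.

Lemma oc_integralZ (k : R) f a b : bounded_measurable f ->
  oc_integral a b (fun t => k * f t) = k * oc_integral a b f.
Proof. by move=> bf; rewrite /oc_integral RintegralZl//; exact: bounded_measurable_oc. Qed.

Lemma oc_integral_cst (k : R) a b : a <= b -> oc_integral a b (fun=> k) = k * (b - a).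
Proof.
move=> ab; rewrite /oc_integral Rintegral_cst//; congr (k * _).
rewrite -[RHS]/(fine (b - a)%:E); congr fine.
apply: (etrans (lebesgue_measure_itv `]a, b])); rewrite /= lte_fin.
case: ltrP => // ba; have -> : a = b by apply/le_anti/andP.
by rewrite subrr.
Qed.

Lemma eq_oc_integral f g a b : (forall t, a < t <= b -> f t = g t) ->
  oc_integral a b f = oc_integral a b g.
Proof. by move=> fg; apply: eq_Rintegral => t; rewrite inE/= in_itv/=; exact: fg. Qed.

Lemma oc_integral_ge0 f a b : (forall t, a < t <= b -> 0 <= f t) ->
  0 <= oc_integral a b f.
Proof. by move=> f0; apply: Rintegral_ge0 => t; rewrite /= in_itv/=; exact: f0. Qed.

Lemma le_oc_integral f g a b : bounded_measurable f -> bounded_measurable g ->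
  (forall t, a < t <= b -> f t <= g t) -> oc_integral a b f <= oc_integral a b g.
Proof.
move=> bf bg fg; rewrite -subr_ge0 -oc_integralB//.
by apply: oc_integral_ge0 => t tab; rewrite subr_ge0 fg.
Qed.

Lemma oc_integral_cat f a b c : bounded_measurable f -> a <= b -> b <= c ->
  oc_integral a c f = oc_integral a b f + oc_integral b c f.
Proof.
move=> bf ab bc; rewrite /oc_integral -Rintegral_setU//.
- by rewrite -itv_bndbnd_setU.
- by rewrite -itv_bndbnd_setU//; exact: bounded_measurable_oc.
- by apply/disj_setPS => y [/=]; rewrite !in_itv/= => /andP[_ yb] /andP[]; rewrite ltNge yb.
Qed.

Lemma oc_integral_affine_ge0 f a b c s : bounded_measurable f ->
  (forall x, 0 <= f x) -> 0 < s ->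
  oc_integral (c + s * a) (c + s * b) f = s * oc_integral a b (fun u => f (c + s * u)).
Proof.
move=> bf f0 s0; have [mf _] := bf.
pose phi := (fun u : R => (c + s * u)%R) : R -> measurableTypeR R.
have mphi : measurable_fun setT phi by exact: measurable_affine.
pose nu := mscale (NngNum (ltW s0)) (pushforward mu phi) : {measure set _ -> \bar R}.
have mEf : measurable_fun setT (EFin \o f : measurableTypeR R -> _).
  exact/measurable_EFinP.
transitivity (fine (\int[nu mphi]_(x in `](c + s * a)%R, (c + s * b)%R]) (f x)%:E)).
  congr fine; apply: eq_measure_integral => A mA _.
  exact: (lebesgue_measure_affine c s0 mA).
rewrite ge0_integral_mscale//=; last by move=> y _; rewrite lee_fin.
  rewrite ge0_integral_pushforward//=; last 2 first.
  - exact: measurable_funTS.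
  - by move=> y _; rewrite lee_fin.
  rewrite (_ : phi @^-1` _ = `]a, b]%classic); last first.
    by apply/seteqP; split=> x /=; rewrite !in_itv/= /phi ltrD2l lerD2l ltr_pM2l// ler_pM2l.
  rewrite fineM//; apply: integrable_fin_num => //.
  by apply: bounded_measurable_oc; exact: bounded_measurable_affine.
exact: measurable_funTS.
Qed.

(** The lemma for non-negative functions applies to [f + M], with [M] a bound of
    [`|f|]. *)
Lemma oc_integral_affine f a b c s : bounded_measurable f -> a <= b -> 0 < s ->
  oc_integral (c + s * a) (c + s * b) f = s * oc_integral a b (fun u => f (c + s * u)).
Proof.
move=> bf ab s0; have [_ [M fM]] := bf.
have bM := bounded_measurable_cst R M.
have bfM := bounded_measurableD bf bM.
have := @oc_integral_affine_ge0 (fun t => f t + M) a b c s bfM.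
rewrite oc_integralD//.
rewrite oc_integralD//; last exact: bounded_measurable_affine.
rewrite !oc_integral_cst//; last by rewrite lerD2l ler_pM2l.
move=> /(_ _ s0) H; have {}H := H _; suff : forall x, 0 <= f x + M by move/H; lra.
by move=> x; have := fM x; rewrite ler_norml => /andP[]; lra.
Qed.

Lemma oc_integral_shift f a b c : bounded_measurable f -> a <= b ->
  oc_integral a b (fun u => f (u + c)) = oc_integral (a + c) (b + c) f.
Proof.
move=> bf ab; have := @oc_integral_affine f a b c 1 bf ab ltr01.
rewrite !mul1r ![c + _]addrC => ->.
by apply: eq_oc_integral => t _; rewrite mul1r addrC.
Qed.

Lemma normr_oc_integral f a b (M : R) : bounded_measurable f -> a <= b ->
  (forall t, a < t <= b -> `|f t| <= M) -> `|oc_integral a b f| <= M * (b - a).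
Proof.
move=> bf ab fM; have bM := bounded_measurable_cst R M.
have bNM := bounded_measurable_cst R (- M).
rewrite ler_norml -mulNr -(oc_integral_cst M ab) -(oc_integral_cst (- M) ab).
by apply/andP; split; apply: le_oc_integral => // t tab; have := fM _ tab;
  rewrite ler_norml => /andP[].
Qed.

(** If the integral were 0, then [f] would vanish almost everywhere on the open
    interval, which has positive length. *)
Lemma oc_integral_gt0 f a b : bounded_measurable f -> a < b ->
  (forall t, a < t < b -> 0 < f t) -> 0 < oc_integral a b f.
Proof.
move=> bf ab f0; have intf := bounded_measurable_oc a b bf.
have intf' : mu.-integrable `]a, b[ (EFin \o f).
  by apply: integrableS intf => //; apply: subset_itvl; rewrite bnd_simp.
rewrite /oc_integral -Rintegral_itv_bndo_bndc//.
rewrite lt_neqAle Rintegral_ge0 ?andbT; last first.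
  by move=> t; rewrite /= in_itv/= => /f0/ltW.
apply/eqP => /esym If0.
have mf : measurable_fun `]a, b[ (EFin \o f) by exact: measurable_int intf'.
have : (\int[mu]_(x in `]a, b[) `|(EFin \o f) x| = 0)%E.
  transitivity (\int[mu]_(x in `]a, b[) (f x)%:E)%E.
    by apply: eq_integral => t; rewrite inE/= in_itv/= => tab; rewrite gtr0_norm// f0.
  by rewrite -[LHS]fineK ?integrable_fin_num//; congr EFin.
move=> /(ae_eq_integral_abs mu (measurable_itv _) mf) ae0.
have : mu.-negligible `]a, b[%classic.
  apply: negligibleS ae0 => t /=; rewrite in_itv/= => tab /(_ tab)[] ft0.
  by have := f0 _ tab; rewrite ft0 ltxx.
move=> /(negligibleP mu (measurable_itv _)) /(etrans (esym (lebesgue_measure_itv `]a, b[))).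
by rewrite /= lte_fin ab -EFinB => -[] /eqP; rewrite subr_eq0 gt_eqF.
Qed.

(** Fubini's theorem for [h] set to 0 outside of the rectangle. *)
Lemma oc_integral_swap (h : R * R -> R) a b c e : bounded_measurable h ->
  oc_integral a b (fun x => oc_integral c e (fun y => h (x, y))) =
  oc_integral c e (fun y => oc_integral a b (fun x => h (x, y))).
Proof.
move=> bh; have [mh [M hM]] := bh.
set A := `]a, b]%classic : set R; set C := `]c, e]%classic : set R.
pose g := (EFin \o h) \_ (A `*` C).
have gE x y : g (x, y) = if x \in A then ((fun t => (h (x, t))%:E) \_ C) y else 0%E.
  by rewrite /g /patch/= in_setX/=; case: (x \in A).
have gE' x y : g (x, y) = if y \in C then ((fun t => (h (t, y))%:E) \_ A) x else 0%E.
  by rewrite /g /patch/= in_setX/=; case: (x \in A); case: (y \in C).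
have b1 x : bounded_measurable (fun y => h (x, y)).
  by apply: bounded_measurable_comp bh; exact: measurable_fun_pair.
have b2 y : bounded_measurable (fun x => h (x, y)).
  by apply: bounded_measurable_comp bh; exact: measurable_fun_pair.
have L : (\int[mu]_(x in A) (oc_integral c e (fun y => h (x, y)))%:E =
          \int[mu]_x \int[mu]_y g (x, y))%E.
  rewrite integral_mkcond; apply: eq_integral => x _.
  under [RHS]eq_integral do rewrite gE.
  rewrite /patch; case: ifPn => xA; last by rewrite integral0.
  rewrite -integral_mkcond /oc_integral /Rintegral fineK//.
  by apply: integrable_fin_num => //; exact: bounded_measurable_oc.
have L' : (\int[mu]_(y in C) (oc_integral a b (fun x => h (x, y)))%:E =
          \int[mu]_y \int[mu]_x g (x, y))%E.
  rewrite integral_mkcond; apply: eq_integral => y _.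
  under [RHS]eq_integral do rewrite gE'.
  rewrite /patch; case: ifPn => yC; last by rewrite integral0.
  rewrite -integral_mkcond /oc_integral /Rintegral fineK//.
  by apply: integrable_fin_num => //; exact: bounded_measurable_oc.
rewrite {1}/oc_integral /Rintegral L.
rewrite [in RHS]/oc_integral /Rintegral L'.
congr fine; apply: (@Fubini _ _ _ _ R mu mu g).
have mA : measurable A by exact: measurable_itv.
have mC : measurable C by exact: measurable_itv.
have mAC : measurable (A `*` C) by exact: measurableX.
have [+ _] := @integrable_mkcond _ (measurableTypeR R * measurableTypeR R)%type
  R (mu \x mu)%E _ (EFin \o h) mAC; apply.
apply: bounded_measurable_integrable => //.
have muAC : ((mu \x mu) (A `*` C) = mu A * mu C)%E by exact: product_measure1E.
suff : (mu A * mu C < +oo)%E by apply: le_lt_trans; rewrite -muAC.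
rewrite -ge0_fin_numE; last by rewrite mule_ge0.
by rewrite fin_numM// ge0_fin_numE// itv_measure_lty.
Qed.

Lemma oc_integral_FTC f (F : R -> R) a b : a <= b ->
  (forall x, is_derive x 1 F (f x)) -> continuous f ->
  bounded_measurable f ->
  oc_integral a b f = F b - F a.
Proof.
rewrite le_eqVlt => /predU1P[<- _ _ _|ab dF cf bf].
  by rewrite subrr /oc_integral set_itvoc0 Rintegral_set0.
rewrite /oc_integral Rintegral_itv_obnd_cbnd; last exact: bounded_measurable_oc.
have cF : continuous F.
  by move=> x; apply/differentiable_continuous/derivable1_diffP; have [] := dF x.
rewrite /Rintegral (@continuous_FTC2 _ f F)//.
- exact: continuous_subspaceT.
- split; first by move=> x _; have [] := dF x.
  + exact/cvg_at_right_filter/cF.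
  + exact/cvg_at_left_filter/cF.
- by move=> x _; rewrite derive1E; have [_ ->] := dF x.
Qed.

End IntegralOnIntervals.

(** * Averages over intervals and unimodality *)

Section Averages.
Context {R : realType}.
Notation mu := (@lebesgue_measure R).
Implicit Types (f g : R -> R) (a b c r s t u x y : R).

Lemma oc_integral_opp f a b : bounded_measurable f ->
  oc_integral (- b) (- a) f = oc_integral a b (fun t => f (- t)).
Proof.
move=> bf; have bfN : bounded_measurable (fun t : R => f (- t)).
  by apply: bounded_measurable_comp bf; exact: oppr_measurable.
pose phi := (fun u : R => - u) : R -> measurableTypeR R.
have mphi : measurable_fun setT phi by exact: oppr_measurable.
have co g d e : bounded_measurable g ->
    \int[mu]_(x in `[d, e[) g x = oc_integral d e g.
  move=> bg; rewrite /oc_integral Rintegral_itv_obnd_cbnd; last exact: bounded_measurable_oc.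
  rewrite -Rintegral_itv_bndo_bndc//.
  apply: bounded_measurable_integrable => //.
  exact: itv_measure_lty.
rewrite -(co _ _ _ bfN) /oc_integral /Rintegral.
transitivity (fine (\int[pushforward mu phi]_(x in `](- b)%R, (- a)%R]) (f x)%:E)).
  congr fine; apply: eq_measure_integral => A mA _.
  exact/esym/lebesgue_measureN.
rewrite integral_pushforward//=.
- by rewrite opp_preimage_itvbndbnd/= !opprK.
- by apply/measurable_EFinP; case: bf.
- rewrite opp_preimage_itvbndbnd/= !opprK.
  apply: bounded_measurable_integrable => //.
  exact: itv_measure_lty.
Qed.

(** If [f] is the density of a random variable V, then [avg s f] is the density of
    V + s U, where U is uniform on [-1/2, 1/2] and independent of V. *)
Definition avg s f x : R := oc_integral (- (1 / 2)) (1 / 2) (fun u => f (x + s * u)).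

Lemma avgE s f x : bounded_measurable f -> 0 < s ->
  avg s f x = s^-1 * oc_integral (x - s / 2) (x + s / 2) f.
Proof.
move=> bf s0; have -> : x - s / 2 = x + s * - (1 / 2) by lra.
have -> : x + s / 2 = x + s * (1 / 2) by lra.
by rewrite oc_integral_affine// ?mulKf ?gt_eqF//; lra.
Qed.

Lemma avg_cst s c x : avg s (fun=> c) x = c.
Proof. by rewrite /avg oc_integral_cst; lra. Qed.

Lemma avgD s f g x : bounded_measurable f -> bounded_measurable g ->
  avg s (fun y => f y + g y) x = avg s f x + avg s g x.
Proof. by move=> bf bg; rewrite /avg oc_integralD//; exact: bounded_measurable_affine. Qed.

Lemma avgZ s c f x : bounded_measurable f ->
  avg s (fun y => c * f y) x = c * avg s f x.
Proof. by move=> bf; rewrite /avg oc_integralZ//; exact: bounded_measurable_affine. Qed.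

Lemma avg_shift s c f x : avg s (fun y => f (y + c)) x = avg s f (x + c).
Proof. by apply: eq_oc_integral => u _; rewrite addrAC. Qed.

Lemma avg_dilate s c f x : avg s (fun y => f (c * y)) x = avg (c * s) f (c * x).
Proof. by apply: eq_oc_integral => u _; rewrite mulrDr mulrA. Qed.

Lemma le_avg s f g x : bounded_measurable f -> bounded_measurable g ->
  (forall y, f y <= g y) -> avg s f x <= avg s g x.
Proof.
by move=> bf bg fg; apply: le_oc_integral => //; exact: bounded_measurable_affine.
Qed.

(** The uniform law on an interval is the even mixture of the uniform laws on its
    two halves. *)
Lemma avg_double s f x : bounded_measurable f -> 0 < s ->
  avg (2 * s) f x = 1 / 2 * (avg s f (x + s / 2) + avg s f (x - s / 2)).
Proof.
move=> bf s0; rewrite !avgE ?mulr_gt0//.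
have -> : x - 2 * s / 2 = x - s / 2 - s / 2 by lra.
have -> : x + 2 * s / 2 = x + s / 2 + s / 2 by lra.
rewrite (@oc_integral_cat _ _ _ x)//; [|lra|lra].
have -> : x - s / 2 + s / 2 = x by lra.
have -> : x + s / 2 - s / 2 = x by lra.
by field; lra.
Qed.

(** The integrated form of the formula (f (x + s/2) - f (x - s/2)) / s for the
    derivative of [avg s f]: since [f] may have jumps, the formula is integrated. *)
Lemma avg_sub s f x y : bounded_measurable f -> 0 < s -> x <= y ->
  avg s f x - avg s f y =
  s^-1 * oc_integral x y (fun v => f (v - s / 2) - f (v + s / 2)).
Proof.
move=> bf s0 xy; rewrite !avgE// -mulrBr; congr (_ * _).
rewrite oc_integralB//; [|exact: bounded_measurable_shift|exact: bounded_measurable_shift].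
rewrite !oc_integral_shift//.
have [yx|/ltW xy'] := lerP (y - s / 2) (x + s / 2).
  (* The two windows overlap: their common part cancels. *)
  rewrite (@oc_integral_cat _ _ (x - s / 2) (y - s / 2))//; [|lra].
  rewrite [X in _ - X](@oc_integral_cat _ _ _ (x + s / 2))//; [|lra].
  by ring.
(* The windows are disjoint: the gap between them is added to both. *)
rewrite [X in _ = X - _](@oc_integral_cat _ _ _ (x + s / 2))//; [|lra].
rewrite [X in _ = _ - X](@oc_integral_cat _ _ _ (y - s / 2))//; [|lra].
by ring.
Qed.

Lemma lipschitz_measurable f (K : R) : 0 <= K ->
  (forall x y, `|f x - f y| <= K * `|x - y|) -> measurable_fun setT f.
Proof.
move=> K0 lip; apply: continuous_measurable_fun => x.
apply/cvgrPdist_lt => e e0; near=> y; apply: le_lt_trans (lip _ _) _.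
have : `|x - y| < e / (K + 1).
  near: y; apply: (@cvgr_dist_lt _ _ _ _ _ id x) => //.
  by rewrite divr_gt0// ltr_wpDl.
rewrite ltr_pdivlMr ?ltr_wpDl//; apply: le_lt_trans.
by rewrite mulrC ler_wpM2l// lerDl.
Unshelve. all: by end_near. Qed.

Lemma avg_bounded_measurable s f : 0 < s -> bounded_measurable f ->
  bounded_measurable (avg s f).
Proof.
move=> s0 bf; have [_ [M fM]] := bf.
have M0 : 0 <= M by exact: le_trans (normr_ge0 _) (fM 0).
split; last first.
  exists M => x; have := @normr_oc_integral _ (fun u => f (x + s * u)) (- (1 / 2)) (1 / 2) M.
  have -> : M * (1 / 2 - - (1 / 2)) = M by lra.
  by apply=> //; [exact: bounded_measurable_affine|lra].
have K0 : 0 <= s^-1 * (2 * M) by rewrite mulr_ge0// ?invr_ge0 ?mulr_ge0// ltW.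
have lip y z : y <= z -> `|avg s f y - avg s f z| <= s^-1 * (2 * M) * (z - y).
  move=> yz; rewrite avg_sub// normrM gtr0_norm ?invr_gt0// -mulrA.
  rewrite ler_pM2l ?invr_gt0//; apply: normr_oc_integral => // [|v _].
    by apply: bounded_measurableB; exact: bounded_measurable_shift.
  rewrite (le_trans (ler_normB _ _))//; have := fM (v - s / 2); have := fM (v + s / 2); lra.
apply: (lipschitz_measurable K0) => y z; have [yz|/ltW zy] := leP y z.
  by rewrite [X in _ * X]distrC (ger0_norm (_ : 0 <= z - y)) ?subr_ge0// lip.
by rewrite distrC (ger0_norm (_ : 0 <= y - z)) ?subr_ge0// lip.
Qed.

(** The sum V + s U + r U' does not depend on the order in which its last two terms
    are added; for densities this is Fubini's theorem. *)
Lemma avgC s r f x : bounded_measurable f ->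
  avg s (avg r f) x = avg r (avg s f) x.
Proof.
move=> bf; rewrite /avg.
rewrite (@oc_integral_swap _ (fun p : R * R => f (x + s * p.1 + r * p.2))); last first.
  apply: bounded_measurable_comp bf.
  by do 2?[apply: measurable_funD => //]; apply: measurable_funM.
by apply: eq_oc_integral => v _; apply: eq_oc_integral => u _; rewrite addrAC.
Qed.

Lemma avg_even s f x : bounded_measurable f -> (forall y, f (- y) = f y) ->
  avg s f (- x) = avg s f x.
Proof.
move=> bf fN; rewrite /avg -[in RHS](opprK (1 / 2)) oc_integral_opp; last first.
  exact: bounded_measurable_affine.
rewrite opprK; apply: eq_oc_integral => u _; rewrite -fN; congr f; ring.
Qed.

(** This says both that [f] is even and that it is non-increasing on the half-line of
    non-negative reals. *)
Definition unimodal f := forall x y, `|x| <= `|y| -> f y <= f x.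

Lemma unimodal_norm f x : unimodal f -> f `|x| = f x.
Proof. by move=> uf; apply/le_anti; rewrite !uf ?normr_id. Qed.

Lemma unimodal_even f x : unimodal f -> f (- x) = f x.
Proof. by move=> uf; rewrite -(unimodal_norm _ uf) normrN unimodal_norm. Qed.

(** For 0 <= x <= y, the integrand in [avg_sub] is non-negative since
    [`|v - s / 2| <= v + s / 2] for v > 0. *)
Lemma avg_unimodal s f : 0 < s -> bounded_measurable f -> unimodal f ->
  unimodal (avg s f).
Proof.
move=> s0 bf uf x y xy.
have avg_norm z : avg s f `|z| = avg s f z.
  have [_|_] := ger0P z; first by [].
  by apply: avg_even => // ?; exact: unimodal_even.
rewrite -(avg_norm x) -(avg_norm y) -subr_ge0 avg_sub//.
apply: mulr_ge0; first by rewrite invr_ge0 ltW.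
apply: oc_integral_ge0 => v /andP[xv _].
have v0 : 0 < v by apply: le_lt_trans xv.
by rewrite subr_ge0 uf// [leRHS]ger0_norm ?ler_norml; [apply/andP; split|]; lra.
Qed.

(** The comparison is pointwise: f (r u) <= f (s u). *)
Lemma le_avg_width s r f : bounded_measurable f -> unimodal f -> 0 <= s -> s <= r ->
  avg r f 0 <= avg s f 0.
Proof.
move=> bf uf s0 sr; apply: le_oc_integral => [||u _]; try exact: bounded_measurable_affine.
by rewrite !add0r uf// !normrM ler_wpM2r// !ger0_norm// (le_trans s0).
Qed.

(** The amount of strictness that the box of width 1 already has. One average over a
    window of width 1 turns it into strict monotonicity on [0, 1/2]. *)
Definition peaked f := forall w, `|w| < 1 / 2 -> f (1 / 2) < f w.

(** In the integrand f (v - 1/2) - f (v + 1/2) of [avg_sub], with 0 < v < 1/2, the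
    value f (1/2) separates the two terms, strictly from the first one. *)
Lemma avg1_decreasing f x y : bounded_measurable f -> unimodal f -> peaked f ->
  0 <= x -> x < y -> y <= 1 / 2 -> avg 1 f y < avg 1 f x.
Proof.
move=> bf uf pf x0 xy y2; rewrite -subr_gt0 avg_sub// ?ltW// invr1 mul1r.
apply: oc_integral_gt0 => // [|v /andP[xv vy]].
  by apply: bounded_measurableB; exact: bounded_measurable_shift.
rewrite subr_gt0; apply: (@le_lt_trans _ _ (f (1 / 2))); last first.
  by apply: pf; rewrite ltr_norml; apply/andP; split; lra.
by apply: uf; rewrite !ger0_norm; lra.
Qed.

Lemma avg1_peaked f : bounded_measurable f -> unimodal f -> peaked f ->
  peaked (avg 1 f).
Proof.
move=> bf uf pf w w2; rewrite -(unimodal_norm w (avg_unimodal ltr01 bf uf)).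
exact: avg1_decreasing.
Qed.

(** With g = [avg 1 f], the inequality g u <= g (s u) is strict for 0 < u < 1/2. *)
Lemma lt_avg_width s f : bounded_measurable f -> unimodal f -> peaked f ->
  0 < s -> s < 1 -> avg 1 (avg 1 f) 0 < avg s (avg 1 f) 0.
Proof.
move=> bf uf pf s0 s1; set g := avg 1 f.
have bg : bounded_measurable g by exact: avg_bounded_measurable.
have ug : unimodal g by exact: avg_unimodal.
have b r : bounded_measurable (fun u => g (0 + r * u)) by exact: bounded_measurable_affine.
rewrite -subr_gt0 /avg -oc_integralB//.
have bB := bounded_measurableB (b s) (b 1).
rewrite (@oc_integral_cat _ _ _ 0)//.
rewrite ltr_wpDl//.
  apply: oc_integral_ge0 => u _; rewrite subr_ge0 ug// !add0r mul1r normrM.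
  by rewrite ler_piMl// ger0_norm// ltW.
apply: oc_integral_gt0 => // u /andP[u0 u2].
rewrite subr_gt0 !add0r mul1r; apply: avg1_decreasing => //.
- by rewrite mulr_ge0// ltW.
- by rewrite gtr_pMl.
- exact: ltW.
Qed.

(** The density of V + s_1 U_1 + ... + s_k U_k when [f] is the density of V. *)
Definition avgs (ss : seq R) f : R -> R := foldr avg f ss.

Lemma avgs_bounded_measurable ss f : all (>%R^~ 0) ss -> bounded_measurable f ->
  bounded_measurable (avgs ss f).
Proof.
move=> + bf; elim: ss => //= s ss ih /andP[s0 ss0].
by apply: avg_bounded_measurable => //; exact: ih.
Qed.

Lemma avgs_unimodal ss f : all (>%R^~ 0) ss -> bounded_measurable f ->
  unimodal f -> unimodal (avgs ss f).
Proof.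
move=> + bf uf; elim: ss => //= s ss ih /andP[s0 ss0].
by apply: avg_unimodal => //; [exact: avgs_bounded_measurable|exact: ih].
Qed.

Lemma avgs_avg ss s f : all (>%R^~ 0) ss -> 0 < s -> bounded_measurable f ->
  avgs ss (avg s f) = avg s (avgs ss f).
Proof.
move=> + s0 bf; elim: ss => //= r ss ih /andP[r0 ss0].
rewrite (ih ss0).
apply/funext => x.
apply: (@avgC r s (avgs ss f)).
exact: avgs_bounded_measurable.
Qed.

Lemma all_nseq1_gt0 n : all (>%R^~ 0) (nseq n (1 : R)).
Proof. by rewrite all_nseq/= ltr01 orbT. Qed.

(** The outermost window, being evaluated at 0, may be widened to 1 by
    [le_avg_width]; once widened, it commutes past the other averages and becomes part
    of the innermost function, and the next window is outermost. *)
Lemma avgs_ge_nseq1 ss f : all (>%R^~ 0) ss -> all (<=%R^~ 1) ss ->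
  bounded_measurable f -> unimodal f ->
  avgs (nseq (size ss) 1) f 0 <= avgs ss f 0.
Proof.
elim: ss f => //= s ss ih f /andP[s0 ss0] /andP[s1 ss1] bf uf.
apply: (@le_trans _ _ (avg 1 (avgs ss f) 0)); last first.
  apply: le_avg_width => //; last exact: ltW.
    exact: avgs_bounded_measurable.
  exact: avgs_unimodal.
rewrite -!avgs_avg// ?all_nseq1_gt0//.
by apply: ih => //; [exact: avg_bounded_measurable|exact: avg_unimodal].
Qed.

Lemma avgs_nseq1_peaked n f : bounded_measurable f -> unimodal f -> peaked f ->
  peaked (avgs (nseq n 1) f).
Proof.
move=> bf uf pf; elim: n => //= n ih; apply: avg1_peaked => //.
  by apply: avgs_bounded_measurable => //; exact: all_nseq1_gt0.
by apply: avgs_unimodal => //; exact: all_nseq1_gt0.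
Qed.

(** The window s is kept for the last step. All the others have then become unit
    windows; as there is at least one of them, [lt_avg_width] makes the last step
    strict. *)
Lemma avgs_gt_nseq1 ss f : (1 < size ss)%N -> all (>%R^~ 0) ss -> all (<%R^~ 1) ss ->
  bounded_measurable f -> unimodal f -> peaked f ->
  avgs (nseq (size ss) 1) f 0 < avgs ss f 0.
Proof.
case: ss => [//|s [//|r ss]] _ /andP[s0 /[dup] rss0 /andP[r0 ss0]] /andP[s1 rss1] bf uf pf.
have nss0 := all_nseq1_gt0 (size ss).
apply: (@lt_le_trans _ _ (avgs (nseq (size (r :: ss)) 1) (avg s f) 0)); last first.
  have -> : avgs [:: s, r & ss] f = avgs (r :: ss) (avg s f) by rewrite avgs_avg.
  apply: avgs_ge_nseq1; first exact: rss0.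
  - by apply: (@sub_all _ (<%R^~ (1 : R))) => // x /ltW.
  - exact: avg_bounded_measurable.
  - exact: avg_unimodal.
rewrite avgs_avg//; last exact: all_nseq1_gt0.
apply: lt_avg_width => //.
- exact: avgs_bounded_measurable.
- exact: avgs_unimodal.
- exact: avgs_nseq1_peaked.
Qed.

End Averages.

(** * The packing bound *)

Section Box.
Context {R : realType}.
Implicit Types (f g : R -> R) (a b c r s t u x y : R).

(** The indicator function of the interval [- a / 2, a / 2], corrected to 1/2 at the
    end points. With this value, and with the difference of two signs as definition,
    [box_double] holds at every point and the sums of integer translates telescope. *)
Definition box a x : R := (Num.sg (x + a / 2) - Num.sg (x - a / 2)) / 2.

Lemma le_sg x y : x <= y -> Num.sg x <= Num.sg y :> R.
Proof. by move=> xy; do 2 case: sgrP; lra. Qed.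

Lemma normr_sg_le1 x : `|Num.sg x| <= 1 :> R.
Proof. by rewrite normr_sg; case: (x != 0). Qed.

Lemma sg_bounded_measurable : bounded_measurable (@Num.sg R).
Proof.
split; last by exists 1 => t; exact: normr_sg_le1.
by apply: nondecreasing_measurable => // x y; exact: le_sg.
Qed.

Lemma box_bounded_measurable a : bounded_measurable (box a).
Proof.
rewrite (_ : box a = fun x => 2^-1 * (Num.sg (x + a / 2) - Num.sg (x - a / 2))).
  apply: bounded_measurableZ; apply: bounded_measurableB;
  by apply: bounded_measurable_shift; exact: sg_bounded_measurable.
by apply/funext => x; rewrite mulrC.
Qed.

Lemma box_ge0 a x : 0 <= a -> 0 <= box a x.
Proof.
move=> a0; rewrite /box; have : Num.sg (x - a / 2) <= Num.sg (x + a / 2) by apply: le_sg; lra.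
lra.
Qed.

Lemma box_double a x : box (2 * a) x = box a (x + a / 2) + box a (x - a / 2).
Proof.
rewrite /box; have -> : x + a / 2 - a / 2 = x by ring.
have -> : x - a / 2 + a / 2 = x by ring.
have -> : x + a / 2 + a / 2 = x + 2 * a / 2 by field.
have -> : x - a / 2 - a / 2 = x - 2 * a / 2 by field.
by ring.
Qed.

Lemma box_dilate c a x : 0 < c -> box (c * a) (c * x) = box a x.
Proof.
by move=> c0; rewrite /box -mulrA -mulrDr -mulrBr !sgrM gtr0_sg// !mul1r.
Qed.

Lemma box1E x : box 1 x = if `|x| < 1 / 2 then 1 else if `|x| == 1 / 2 then 1 / 2 else 0.
Proof.
rewrite /box; case: ltrgtP => [|x2|x2].
- rewrite ltr_norml => /andP[x1 x2]; rewrite gtr0_sg; last lra.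
  by rewrite ltr0_sg; lra.
- have [x0|x0] := ger0P x.
    by move: x2; rewrite ger0_norm// => x2; rewrite !gtr0_sg; lra.
  by move: x2; rewrite ltr0_norm// => x2; rewrite !ltr0_sg; lra.
- have [x0|x0] := ger0P x.
    move: x2; rewrite ger0_norm// => ->; rewrite subrr sgr0 gtr0_sg; lra.
  move: x2; rewrite ltr0_norm// => x2; have -> : x = - (1 / 2) by lra.
  by rewrite addNr sgr0 ltr0_sg; lra.
Qed.

Lemma box1_unimodal : unimodal (box 1).
Proof. by move=> x y xy; rewrite !box1E; do 2 case: ltrgtP => ?; lra. Qed.

Lemma box1_peaked : peaked (box 1).
Proof.
move=> w w2; rewrite !box1E w2 (ger0_norm (_ : 0 <= 1 / 2)) ?divr_ge0// ltxx eqxx; lra.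
Qed.

(** The sum of all integer translates of the box is the constant a. A bound for part of
    the sum suffices: it is extended to an initial segment of the natural numbers,
    where the differences of signs telescope. *)
Lemma sum_box_le (a : nat) (s : seq nat) x : uniq s ->
  \sum_(m <- s) box a%:R (x - m%:R) <= a%:R.
Proof.
move=> us; have [M sM] : exists M, {subset s <= iota 0 M}.
  exists (\max_(m <- s) m).+1 => m ms.
  by rewrite mem_iota add0n /= ltnS; exact: leq_bigmax_seq.
apply: (@le_trans _ _ (\sum_(m <- iota 0 M) box a%:R (x - m%:R))).
  rewrite [leRHS](bigID (mem s))/= -[leLHS]addr0 lerD//; last first.
    by apply: sumr_ge0 => m _; exact: box_ge0.
  rewrite -[leRHS]big_filter le_eqVlt; apply/orP; left; apply/eqP.
  apply: perm_big; apply: uniq_perm => // [|m].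
    by apply: filter_uniq; exact: iota_uniq.
  by rewrite mem_filter; case: (boolP (m \in s)) => // /sM ->.
pose phi (m : nat) := Num.sg (x + a%:R / 2 - m%:R) : R.
have boxE m : box a%:R (x - m%:R) = 2^-1 * \sum_(j < a) (phi (m + j)%N - phi (m + j.+1)%N).
  rewrite -(big_mkord xpredT (fun j => phi (m + j)%N - phi (m + j.+1)%N)).
  rewrite (@telescope_sumr_eq _ 0 a (fun j => - phi (m + j)%N))//; last first.
    by move=> j _; rewrite opprK addrC.
  rewrite opprK [- _ + _]addrC /box /phi addn0 natrD mulrC.
  by congr (_ * (Num.sg _ - Num.sg _)); lra.
have -> : iota 0 M = index_iota 0 M by rewrite /index_iota subn0.
under eq_bigr do rewrite boxE.
rewrite -mulr_sumr exchange_big/= ler_pdivrMl//.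
have -> : (2 : R) * a%:R = \sum_(j < a) 2 by rewrite sumr_const card_ord mulr_natr.
apply: ler_sum => j _.
rewrite (@telescope_sumr_eq _ 0 M (fun m => - phi (m + j)%N))//; last first.
  by move=> m _; rewrite opprK addrC addSnnS.
rewrite opprK add0n; have := normr_sg_le1 (x + a%:R / 2 - j%:R).
have := normr_sg_le1 (x + a%:R / 2 - (M + j)%:R); rewrite -!/(phi _) !ler_norml; lra.
Qed.

Lemma bounded_measurable_sum (I : Type) (s : seq I) (F : I -> R -> R) :
  (forall i, bounded_measurable (F i)) ->
  bounded_measurable (fun x => \sum_(i <- s) F i x).
Proof.
move=> bF; elim: s => [|i s ih].
  rewrite (_ : (fun _ => _) = fun=> 0); first exact: bounded_measurable_cst.
  by apply/funext => x; rewrite big_nil.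
rewrite (_ : (fun _ => _) = fun x => F i x + \sum_(j <- s) F j x).
  exact: bounded_measurableD.
by apply/funext => x; rewrite big_cons.
Qed.

Lemma avg_sum r (I : Type) (s : seq I) (F : I -> R -> R) x :
  (forall i, bounded_measurable (F i)) ->
  avg r (fun y => \sum_(i <- s) F i y) x = \sum_(i <- s) avg r (F i) x.
Proof.
move=> bF; elim: s => [|i s ih].
  by rewrite big_nil -[RHS](avg_cst r 0 x); congr avg; apply/funext => y; rewrite big_nil.
rewrite big_cons -ih -avgD//; last exact: bounded_measurable_sum.
by congr avg; apply/funext => y; rewrite big_cons.
Qed.

Lemma avgs_dilate c ss f x : bounded_measurable f ->
  avgs ss (fun y => f (c * y)) x = avgs [seq c * s | s <- ss] f (c * x).
Proof.
move=> bf; elim: ss x => //= s ss ih x; rewrite -avg_dilate.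
by congr avg; apply/funext => y; exact: ih.
Qed.

Lemma avgsD ss f g x : all (>%R^~ 0) ss -> bounded_measurable f -> bounded_measurable g ->
  avgs ss (fun y => f y + g y) x = avgs ss f x + avgs ss g x.
Proof.
move=> + bf bg; elim: ss x => //= s ss ih x /andP[s0 ss0].
rewrite -avgD; [|exact: avgs_bounded_measurable|exact: avgs_bounded_measurable].
by congr avg; apply/funext => y; exact: ih.
Qed.

Lemma avgsZ ss c f x : all (>%R^~ 0) ss -> bounded_measurable f ->
  avgs ss (fun y => c * f y) x = c * avgs ss f x.
Proof.
move=> + bf; elim: ss x => //= s ss ih x /andP[s0 ss0].
rewrite -avgZ; last exact: avgs_bounded_measurable.
by congr avg; apply/funext => y; exact: ih.
Qed.

Lemma avgs_shift ss f c x : avgs ss (fun y => f (y + c)) x = avgs ss f (x + c).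
Proof.
elim: ss x => //= s ss ih x; rewrite -avg_shift.
by congr avg; apply/funext => y; exact: ih.
Qed.

(** Averaging commutes with sums and translations, and fixes the constant c. *)
Lemma sum_avgs_le ss f c (s : seq nat) x : all (>%R^~ 0) ss -> bounded_measurable f ->
  (forall y, \sum_(m <- s) f (y - m%:R) <= c) ->
  \sum_(m <- s) avgs ss f (x - m%:R) <= c.
Proof.
move=> + bf fc; elim: ss x => [x _|r ss ih x /= /andP[r0 ss0]]; first exact: fc.
have b m : bounded_measurable (fun y => avgs ss f (y - m%:R)).
  by apply: bounded_measurable_shift; exact: avgs_bounded_measurable.
under eq_bigr do rewrite -avg_shift.
rewrite -(avg_sum r s x b) -[leRHS](avg_cst r c x).
apply: le_avg; [exact: bounded_measurable_sum|exact: bounded_measurable_cst|].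
by move=> y; exact: ih.
Qed.

Fixpoint subset_sums (l : seq nat) : seq nat :=
  if l is a :: l' then subset_sums l' ++ [seq (a + m)%N | m <- subset_sums l']
  else [:: 0%N].

Definition reals (l : seq nat) : seq R := [seq k%:R | k : nat <- l].

Lemma reals_gt0 l : all (ltn 0) l -> all (>%R^~ 0) (reals l).
Proof. by rewrite /reals all_map; apply: sub_all => k /=; rewrite ltr0n. Qed.

(** By [avg_double], each summand 2 a U of the random sum may be replaced by a U + a / 2
    or a U - a / 2, each with probability 1/2. A choice of signs corresponds to the set
    of the a that come with a minus sign, and the resulting shift is half of the total
    sum minus the sum over this set. *)
Lemma avgs_double l f x : all (ltn 0) l -> bounded_measurable f ->
  avgs [seq 2 * s | s <- reals l] f x =
  2^-1 ^+ size l * \sum_(m <- subset_sums l) avgs (reals l) f (x + (sumn l)%:R / 2 - m%:R).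
Proof.
move=> + bf; elim: l x => [x _|a l ih x /= /andP[a0 l0]].
  by rewrite /= big_seq1 expr0 mul1r mul0r addr0 subr0.
have aR : 0 < a%:R :> R by rewrite ltr0n.
have b m c : bounded_measurable (fun y => avgs (reals l) f (y + c - m%:R)).
  apply: (@bounded_measurable_shift _ (fun y => avgs (reals l) f (y - m%:R))).
  by apply: bounded_measurable_shift; apply: avgs_bounded_measurable => //; exact: reals_gt0.
set F := (X in avg _ X); have {ih}-> : F = fun y => 2^-1 ^+ size l *
    \sum_(m <- subset_sums l) avgs (reals l) f (y + (sumn l)%:R / 2 - m%:R).
  by apply/funext => y; exact: ih.
have bS := bounded_measurable_sum (subset_sums l) (b ^~ ((sumn l)%:R / 2)).
rewrite avg_double//; last exact: bounded_measurableZ.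
rewrite !avgZ// !avg_sum// -mulrDr mulrA mul1r -exprS big_cat big_map/=.
congr (_ * (_ + _)); apply: eq_bigr => m _.
  rewrite (@avg_shift _ _ _ (fun y => avgs (reals l) f (y - m%:R))) avg_shift.
  by congr avg; rewrite natrD; lra.
rewrite (@avg_shift _ _ _ (fun y => avgs (reals l) f (y - m%:R))) avg_shift.
by congr avg; rewrite !natrD; lra.
Qed.

(** Scaling by 2 a turns the left-hand side into an average, over all subset sums m of
    [a :: l], of translates by m of one and the same density (up to the normalization
    of the box). As the m are distinct, [sum_avgs_le] and [sum_box_le] bound the sum of
    these translates by a, and 2 ^ (size l) is what remains of the normalization. *)
Lemma avgs_box_le (a : nat) l : (0 < a)%N -> all (ltn 0) l -> uniq (subset_sums (a :: l)) ->
  avgs [seq s / a%:R | s <- reals l] (box 1) 0 <= a%:R / 2 ^+ size l.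
Proof.
move=> a0 l0 ul; have aR : 0 < a%:R :> R by rewrite ltr0n.
have rl := reals_gt0 l0.
have r2l : all (>%R^~ 0) [seq 2 * s | s <- reals l].
  by rewrite all_map; apply: sub_all rl => s /= s0; rewrite mulr_gt0.
have bb := box_bounded_measurable a%:R.
rewrite (_ : box 1 = fun x => box (2 * a%:R) (2 * a%:R * x)); last first.
  by apply/funext => x; rewrite -(@box_dilate (2 * a%:R) 1 x) ?mulr1// mulr_gt0.
rewrite avgs_dilate; last exact: box_bounded_measurable.
rewrite mulr0 -map_comp (@eq_map _ _ _ ( *%R 2)); last first.
  by move=> s /=; field; rewrite gt_eqF.
rewrite (_ : box (2 * a%:R) =
    fun x => box a%:R (x + a%:R / 2) + box a%:R (x + - (a%:R / 2))); last first.
  by apply/funext => x; rewrite box_double.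
rewrite avgsD//; [|exact: bounded_measurable_shift|exact: bounded_measurable_shift].
rewrite !avgs_shift !avgs_double// -mulrDr exprVn mulrC ler_pM2r ?invr_gt0 ?exprn_gt0//.
rewrite !add0r.
apply: le_trans (sum_avgs_le ((sumn (a :: l))%:R / 2) rl bb (fun y => sum_box_le a y ul)).
rewrite /= big_cat big_map/= le_eqVlt; apply/orP; left; apply/eqP.
by congr (_ + _); apply: eq_bigr => m _; congr avgs; rewrite !natrD; lra.
Qed.

End Box.

Lemma subset_sums_mem (T : finType) (b : T -> nat) (s : seq T) m : uniq s ->
  m \in subset_sums [seq b i | i <- s] ->
  exists2 I : {set T}, m = (\sum_(i in I) b i)%N & {subset I <= s}.
Proof.
elim: s m => [m _|j s ih m /= /andP[js us]].
  by rewrite inE => /eqP ->; exists finset.set0; [rewrite big_set0|move=> i; rewrite inE].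
rewrite mem_cat => /orP[/(ih _ us)[I -> Is]|/mapP[m' /(ih _ us)[I -> Is] ->]].
  by exists I => // i /Is; rewrite inE orbC => ->.
exists (j |: I)%SET.
  by rewrite big_setU1//; apply/negP => /Is; rewrite (negbTE js).
by move=> i; rewrite !inE => /orP[->//|/Is ->]; rewrite orbT.
Qed.

(** A value shared by the sums with b j and the sums without b j would be the sum over two
    distinct sets. *)
Lemma subset_sums_uniq (T : finType) (b : T -> nat) (s : seq T) : uniq s ->
  (forall I J : {set T}, I != J -> (\sum_(i in I) b i <> \sum_(j in J) b j)%N) ->
  uniq (subset_sums [seq b i | i <- s]).
Proof.
move=> + H; elim: s => //= j s ih /andP[js us].
rewrite cat_uniq ih// map_inj_uniq ?ih ?andbT//=; last exact: addnI.
apply/hasPn => m /mapP[m' /(subset_sums_mem us)[J -> Js] ->{m}].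
apply/negP => /(subset_sums_mem us)[I + Is].
rewrite -big_setU1/=; last by apply/negP => /Js; rewrite (negbTE js).
apply: H; apply/eqP => JI; have /Is : j \in I by rewrite -JI !inE eqxx.
by rewrite (negbTE js).
Qed.

(** * The sinc integral as a density *)

Section Sinc.
Context {R : realType}.
Notation mu := (@lebesgue_measure R).
Implicit Types (f g : R -> R) (a b c r s t u x y : R).

Definition sinc t : R := sin t / t.

Lemma cos_bounded_measurable : bounded_measurable (@cos R).
Proof.
split; first by apply: continuous_measurable_fun; exact: continuous_cos.
by exists 1; exact: cos_max.
Qed.

Lemma is_derive_sin_scale c x : c != 0 ->
  is_derive x 1 (fun t => sin (c * t) / c) (cos (c * x)).
Proof.
move=> c0.
have H : is_derive x 1 (c^-1 \*: (@sin R \o (c \*: id))) (c^-1 *: (cos (c * x) * (c *: 1))).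
  apply: is_deriveZ.
rewrite (_ : (fun t => sin (c * t) / c) = c^-1 \*: (@sin R \o (c \*: id))).
  by apply: is_derive_eq H _; rewrite /GRing.scale/=; field.
by apply/funext => t /=; rewrite mulrC.
Qed.

Lemma cos_integral c a b : c != 0 -> a <= b ->
  oc_integral a b (fun t => cos (c * t)) = (sin (c * b) - sin (c * a)) / c.
Proof.
move=> c0 ab; rewrite mulrBl; apply: (@oc_integral_FTC _ _ (fun t => sin (c * t) / c)) => //.
- by move=> x; exact: is_derive_sin_scale.
- by move=> x; apply: continuous_comp; [exact: mulrl_continuous|exact: continuous_cos].
rewrite (_ : (fun _ => _) = fun t => cos (0 + c * t)).
  by apply: bounded_measurable_affine; exact: cos_bounded_measurable.
by apply/funext => t; rewrite add0r.
Qed.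

(** Integrate cos <= 1. *)
Lemma sin_le t : 0 <= t -> sin t <= t.
Proof.
move=> t0; have := @cos_integral 1 0 t (oner_neq0 _) t0.
rewrite mulr0 sin0 subr0 divr1 mul1r => <-.
have := @oc_integral_cst _ 1 0 t t0; rewrite mul1r subr0 => {2}<-.
apply: le_oc_integral => [||u _]; last by rewrite mul1r cos_le1.
- rewrite (_ : (fun _ => _) = cos); first exact: cos_bounded_measurable.
  by apply/funext => u; rewrite mul1r.
- exact: bounded_measurable_cst.
Qed.

(** Integrate cos t <= cos u over 0 < u <= t. *)
Lemma mul_cos_le_sin t : 0 <= t -> t <= pi / 2 -> t * cos t <= sin t.
Proof.
move=> t0 tpi; have := @cos_integral 1 0 t (oner_neq0 _) t0.
rewrite mulr0 sin0 subr0 divr1 mul1r => <-.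
have := @oc_integral_cst _ (cos t) 0 t t0; rewrite subr0 mulrC => <-.
apply: le_oc_integral => [||u /andP[u0 ut]]; first exact: bounded_measurable_cst.
- rewrite (_ : (fun _ => _) = cos); first exact: cos_bounded_measurable.
  by apply/funext => u; rewrite mul1r.
- rewrite mul1r leNgt ltr_cos ?in_itv/= -?leNgt//; have := pi_gt0 R; lra.
Qed.

Lemma normr_sin_le t : `|sin t| <= `|t|.
Proof.
wlog t0 : t / 0 <= t => [H|].
  have [/H//|/ltW t0] := lerP 0 t.
  by have := H (- t); rewrite sinN !normrN oppr_ge0; apply.
rewrite (ger0_norm t0) ler_norml sin_le// andbT; have [tpi|pit] := lerP t pi.
  by apply: le_trans (sin_ge0_pi _); [lra|rewrite t0].
by have := sin_geN1 t; have := pi_ge2 R; lra.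
Qed.

Lemma normr_sinc_le1 t : `|sinc t| <= 1.
Proof.
rewrite /sinc normrM normfV; have [->|t0] := eqVneq t 0.
  by rewrite normr0 invr0 mulr0.
by rewrite ler_pdivrMr ?normr_gt0// mul1r normr_sin_le.
Qed.

Lemma cos_lipschitz x y : `|cos x - cos y| <= `|x - y|.
Proof.
have key (p d : R) : `|cos (p + d) - cos (p - d)| <= `|2 * d|.
  rewrite cosB cosD (_ : _ - _ = - (2 * sin p * sin d)); last by ring.
  rewrite normrN !normrM ger0_norm//.
  have := normr_sin_le d; have := sin_max p; have := normr_ge0 (sin d).
  nra.
have := key ((x + y) / 2) ((x - y) / 2).
have -> : (x + y) / 2 + (x - y) / 2 = x by field.
have -> : (x + y) / 2 - (x - y) / 2 = y by field.
by have -> : 2 * ((x - y) / 2) = x - y by field.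
Qed.

Lemma inv_measurable : measurable_fun setT (@GRing.inv R).
Proof.
rewrite -(setUv [set (0 : R)]); apply/measurable_funU => //.
- exact: measurableC.
- split; first exact: measurable_fun_set1.
  apply: open_continuous_measurable_fun.
    exact/closed_openC/closed_eq.
  by move=> x; rewrite inE/= => /eqP x0; exact: inv_continuous.
Qed.

Lemma sinc_bounded_measurable : bounded_measurable sinc.
Proof.
split; last by exists 1; exact: normr_sinc_le1.
apply: measurable_funM; last exact: inv_measurable.
by apply: continuous_measurable_fun; exact: continuous_sin.
Qed.

(** The uniform law on [-1/2, 1/2] has characteristic function sinc t at 2 t: this is how
    repeated averages produce powers of sinc. *)
Lemma avg_cos t x : t != 0 ->
  avg 1 (fun y => cos (2 * t * y)) x = sinc t * cos (2 * t * x).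
Proof.
move=> t0; have b : bounded_measurable (fun y => cos (2 * t * y)).
  rewrite (_ : (fun _ => _) = fun y => cos (0 + 2 * t * y)).
    by apply: bounded_measurable_affine; exact: cos_bounded_measurable.
  by apply/funext => y; rewrite add0r.
rewrite avgE// invr1 mul1r cos_integral ?mulf_neq0//; last lra.
have -> : 2 * t * (x + 1 / 2) = 2 * t * x + t by field.
have -> : 2 * t * (x - 1 / 2) = 2 * t * x - t by field.
by rewrite sinB sinD /sinc; field.
Qed.

Definition cos_transform (phi : R -> R) b x : R :=
  oc_integral 0 b (fun t => phi t * cos (2 * t * x)).

Lemma cos_transform_bounded_measurable phi b : 0 <= b -> bounded_measurable phi ->
  bounded_measurable (cos_transform phi b).
Proof.
move=> b0 bphi; have [_ [M phiM]] := bphi.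
have M0 : 0 <= M by exact: le_trans (normr_ge0 _) (phiM 0).
have bc x : bounded_measurable (fun t => phi t * cos (2 * t * x)).
  apply: bounded_measurableM => //; apply: bounded_measurable_comp cos_bounded_measurable.
  by apply: measurable_funM => //; exact: measurable_funM.
split; last first.
  exists (M * (b - 0)) => x; apply: normr_oc_integral => // t _.
  by rewrite normrM -[leRHS]mulr1 ler_pM// cos_max.
apply: (@lipschitz_measurable _ _ (M * (2 * b) * b)) => [|x y].
  by rewrite !mulr_ge0.
rewrite -oc_integralB// mulrAC -[X in _ * X]subr0; apply: normr_oc_integral => // [|t /andP[t0 tb]].
  exact: bounded_measurableB.
rewrite -mulrBr normrM -[leRHS]mulrA ler_pM//; apply: le_trans (cos_lipschitz _ _) _.
rewrite -mulrBr normrM ler_wpM2r// gtr0_norm ?mulr_gt0//; lra.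
Qed.

Lemma avg_cos_transform phi b x : bounded_measurable phi ->
  avg 1 (cos_transform phi b) x = cos_transform (fun t => phi t * sinc t) b x.
Proof.
move=> bphi; rewrite /avg /cos_transform.
rewrite (@oc_integral_swap _
    (fun p : R * R => phi p.2 * cos (2 * p.2 * (x + 1 * p.1)))); last first.
  apply: bounded_measurableM; first exact: bounded_measurable_comp.
  apply: bounded_measurable_comp cos_bounded_measurable.
  apply: measurable_funM; first exact: measurable_funM.
  by apply: measurable_funD => //; exact: measurable_funM.
apply: eq_oc_integral => t /andP[t0 _] /=; rewrite -mulrA -avg_cos ?gt_eqF//.
rewrite /avg -oc_integralZ//.
apply: bounded_measurable_comp cos_bounded_measurable.
by apply: measurable_funM => //; apply: measurable_affine.
Qed.

(** The Dirichlet kernel 1 + 2 cos (2 t) + ... + 2 cos (2 k t). *)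
Fixpoint dirichlet k t : R :=
  if k is k'.+1 then dirichlet k' t + 2 * cos (2 * k%:R * t) else 1.

Lemma dirichlet_bounded_measurable k : bounded_measurable (dirichlet k).
Proof.
elim: k => [|k ih]; first exact: bounded_measurable_cst.
apply: bounded_measurableD => //; apply: bounded_measurableZ.
apply: bounded_measurable_comp cos_bounded_measurable.
exact: measurable_funM.
Qed.

Lemma dirichletE k t : dirichlet k t * sin t = sin ((2 * k%:R + 1) * t).
Proof.
elim: k => [|k ih]; first by rewrite /= mul1r mulr0 add0r mul1r.
rewrite [dirichlet _ _]/= mulrDl ih -(natr1 k).
have -> : (2 * (k%:R + 1) + 1) * t = 2 * (k%:R + 1) * t + t by ring.
have -> : (2 * k%:R + 1) * t = 2 * (k%:R + 1) * t - t by ring.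
rewrite sinB sinD; ring.
Qed.

Lemma sin_natpi k : sin (k%:R * pi) = 0 :> R.
Proof.
elim: k => [|k ih]; first by rewrite mul0r sin0.
by rewrite -(natr1 k) mulrDl mul1r sinDpi ih oppr0.
Qed.

Lemma dirichlet_integral k : oc_integral 0 (pi / 2) (dirichlet k) = pi / 2.
Proof.
have pi0 := pi_gt0 R; elim: k => [|k ih].
  by rewrite oc_integral_cst; lra.
have bc : bounded_measurable (fun t : R => cos (2 * k.+1%:R * t)).
  by apply: bounded_measurable_comp cos_bounded_measurable; exact: measurable_funM.
rewrite oc_integralD; [|exact: dirichlet_bounded_measurable|exact: bounded_measurableZ].
rewrite oc_integralZ// ih cos_integral//; last lra.
have -> : 2 * k.+1%:R * (pi / 2) = k.+1%:R * pi :> R by field.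
by rewrite sin_natpi mulr0 sin0 subrr mul0r mulr0 addr0.
Qed.

(** n times the Fejer kernel, in the variable 2 t. *)
Definition fejer n t : R := \sum_(k < n) dirichlet k t.

(** Each term contributes sin ((2 k + 1) t) sin t, which equals
    sin^2 ((k + 1) t) - sin^2 (k t). *)
Lemma fejerE n t : fejer n t * sin t ^+ 2 = sin (n%:R * t) ^+ 2.
Proof.
rewrite /fejer; elim: n => [|n ih]; first by rewrite big_ord0 mul0r mul0r sin0 expr0n.
rewrite big_ord_recr/= mulrDl ih [sin t ^+ 2]expr2 [X in _ + X]mulrA dirichletE -(natr1 n).
have -> : (2 * n%:R + 1) * t = n%:R * t + (n%:R * t + t) by ring.
have -> : (n%:R + 1) * t = n%:R * t + t by ring.
have := cos2Dsin2 t; have := cos2Dsin2 (n%:R * t).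
rewrite !sinD !cosD; set C := cos (n%:R * t); set S := sin (n%:R * t).
move=> H1 H2; have E1 : C ^+ 2 = 1 - S ^+ 2 by lra.
have E2 : sin t ^+ 2 = 1 - cos t ^+ 2 by lra.
nra.
Qed.

Lemma fejer_bounded_measurable n : bounded_measurable (fejer n).
Proof.
rewrite /fejer (_ : (fun _ => _) = fun t => \sum_(k <- index_enum 'I_n) dirichlet k t)//.
by apply: bounded_measurable_sum => k; exact: dirichlet_bounded_measurable.
Qed.

Lemma fejer_integral n : oc_integral 0 (pi / 2) (fejer n) = n%:R * (pi / 2).
Proof.
elim: n => [|n ih].
  rewrite (_ : fejer 0 = fun=> 0); first by rewrite oc_integral_cst ?mul0r// divr_ge0// pi_ge0.
  by apply/funext => t; rewrite /fejer big_ord0.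
rewrite (_ : fejer n.+1 = fun t => fejer n t + dirichlet n t); last first.
  by apply/funext => t; rewrite /fejer big_ord_recr.
rewrite oc_integralD; [|exact: fejer_bounded_measurable|exact: dirichlet_bounded_measurable].
by rewrite ih dirichlet_integral -(natr1 n); field.
Qed.

Definition sinc2_integral b : R := oc_integral 0 b (fun t => sinc t ^+ 2).

Lemma sinc2_bounded_measurable : bounded_measurable (fun t => sinc t ^+ 2).
Proof. by apply: bounded_measurableX; exact: sinc_bounded_measurable. Qed.

Lemma sinc2_integral_scale c b : 0 < c -> 0 <= b ->
  sinc2_integral (c * b) = c * oc_integral 0 b (fun t => sinc (c * t) ^+ 2).
Proof.
move=> c0 b0; have := @oc_integral_affine _ _ 0 b 0 c sinc2_bounded_measurable b0 c0.
rewrite mulr0 !add0r /sinc2_integral => ->.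
by congr (_ * _); apply: eq_oc_integral => t _; rewrite add0r.
Qed.

(** The substitution t = n u reduces the claim to the integral of sin^2 (n u) / u^2 over
    [0, pi / 2]. By t cos t <= sin t <= t, one has 1/u^2 <= 1/sin^2 u <= 1 + 1/u^2, so
    that this integrand differs by at most 1 from the Fejer kernel, whose integral is
    n pi / 2. *)
Lemma sinc2_integral_nat n : (0 < n)%N ->
  pi / 2 - pi / 2 / n%:R <= sinc2_integral (n%:R * (pi / 2)) <= pi / 2.
Proof.
move=> n0; have nR : 0 < n%:R :> R by rewrite ltr0n.
have pi0 := pi_gt0 R; have pi2 : 0 <= pi / 2 :> R by lra.
have bs : bounded_measurable (fun t : R => sinc (n%:R * t) ^+ 2).
  apply: bounded_measurable_comp sinc2_bounded_measurable; exact: measurable_funM.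
have bns := bounded_measurableZ (n%:R ^+ 2) bs.
have bf := fejer_bounded_measurable n.
rewrite sinc2_integral_scale//; set I := oc_integral _ _ _.
have pt t : 0 < t <= pi / 2 ->
    n%:R ^+ 2 * sinc (n%:R * t) ^+ 2 <= fejer n t <= 1 + n%:R ^+ 2 * sinc (n%:R * t) ^+ 2.
  move=> /andP[t0 t2]; have st0 : 0 < sin t by apply: sin_gt0_pi; lra.
  have -> : n%:R ^+ 2 * sinc (n%:R * t) ^+ 2 = sin (n%:R * t) ^+ 2 / t ^+ 2.
    by rewrite /sinc; field; rewrite !gt_eqF.
  have fE := fejerE n t; set S := sin (n%:R * t) ^+ 2 in fE *.
  have S0 : 0 <= S by exact: sqr_ge0.
  have -> : fejer n t = S / sin t ^+ 2 by rewrite -fE mulfK// gt_eqF// exprn_gt0.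
  have t20 : 0 < t ^+ 2 by rewrite exprn_gt0.
  have s20 : 0 < sin t ^+ 2 by rewrite exprn_gt0.
  have st : sin t ^+ 2 <= t ^+ 2.
    by rewrite ler_sqr ?nnegrE; [exact/sin_le/ltW|exact: ltW|exact: ltW].
  have tc : (t * cos t) ^+ 2 <= sin t ^+ 2.
    have c0 : 0 <= cos t by apply: cos_ge0_pihalf; lra.
    rewrite ler_sqr ?nnegrE; [|by rewrite mulr_ge0// ltW|exact: ltW].
    by apply: mul_cos_le_sin => //; exact: ltW.
  apply/andP; split; first by rewrite ler_wpM2l// lef_pV2.
  rewrite ler_pdivrMr// mulrDl mul1r -[in leLHS](mulr1 S) -(cos2Dsin2 t) mulrDr addrC.
  rewrite lerD//.
    have : S <= 1.
      by have := cos2Dsin2 (n%:R * t); have := sqr_ge0 (cos (n%:R * t)); rewrite /S; lra.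
    by move=> S1; rewrite ler_piMl// ltW.
  by rewrite -[leRHS]mulrA ler_wpM2l// [leRHS]mulrC ler_pdivlMr// [leLHS]mulrC -exprMn.
have L1 : n%:R ^+ 2 * I <= n%:R * (pi / 2).
  rewrite -oc_integralZ// -fejer_integral; apply: le_oc_integral => // t /pt/andP[]//.
have L2 : n%:R * (pi / 2) <= pi / 2 + n%:R ^+ 2 * I.
  have c1 : oc_integral 0 (pi / 2) (fun=> 1 : R) = pi / 2 by rewrite oc_integral_cst//; lra.
  have b1 := bounded_measurable_cst R (1 : R).
  rewrite -oc_integralZ// -fejer_integral -[X in _ <= X + _]c1 -oc_integralD//.
  apply: le_oc_integral => // [|t /pt/andP[]//].
  exact: bounded_measurableD.
rewrite expr2 -mulrA in L1; rewrite expr2 -mulrA in L2.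
rewrite -(ler_pM2l nR) -[X in _ && X](ler_pM2l nR) L1 andbT mulrBr.
rewrite [n%:R * (_ / n%:R)]mulrC divfK ?gt_eqF//; lra.
Qed.

Lemma sinc2_integral_le a b : 0 <= a -> a <= b -> sinc2_integral a <= sinc2_integral b.
Proof.
move=> a0 ab; rewrite /sinc2_integral [leRHS](@oc_integral_cat _ _ _ a)//; last first.
  exact: sinc2_bounded_measurable.
by rewrite lerDl; apply: oc_integral_ge0 => t _; exact: sqr_ge0.
Qed.

(** Round b down and up to a multiple of pi / 2; pi^2 is a convenient constant that
    absorbs the rounding. *)
Lemma sinc2_integral_bounds b : 0 < b ->
  pi / 2 - pi ^+ 2 / b <= sinc2_integral b <= pi / 2.
Proof.
move=> b0; have pi0 := pi_gt0 R; pose n := Num.truncn (b / (pi / 2)).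
have /andP[nb bn] : n%:R <= b / (pi / 2) < n.+1%:R.
  by apply: truncn_itv; rewrite divr_ge0// ltW// divr_gt0.
rewrite ler_pdivlMr ?divr_gt0// in nb; rewrite ltr_pdivrMr ?divr_gt0// in bn.
apply/andP; split; last first.
  have /andP[_] := sinc2_integral_nat (ltn0Sn n); apply: le_trans.
  by apply: sinc2_integral_le; exact: ltW.
have [n0|n0] := posnP n.
  apply: (@le_trans _ _ 0); last by apply: oc_integral_ge0 => t _; exact: sqr_ge0.
  rewrite subr_le0 ler_pdivlMr//; move: bn; rewrite n0 mul1r => bn; nra.
have /andP[L _] := sinc2_integral_nat n0.
apply: le_trans (sinc2_integral_le _ nb); last by rewrite mulr_ge0// ltW// divr_gt0.
apply: le_trans L; have nR : 1 <= n%:R :> R by rewrite ler1n.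
rewrite lerD2l lerN2 ler_pdivlMr// mulrAC ler_pdivrMr ?(lt_le_trans ltr01 nR)//.
rewrite -(natr1 n) in bn; nra.
Qed.

(** The integrand is sin^2 (c t) / t^2. What matters is that the error term does not
    depend on c. *)
Lemma scaled_sinc2_bounds c b : 0 < b ->
  `|c| * (pi / 2) - pi ^+ 2 / b <=
    oc_integral 0 b (fun t => c ^+ 2 * sinc (c * t) ^+ 2) <= `|c| * (pi / 2).
Proof.
move=> b0; have bs (d : R) : bounded_measurable (fun t : R => sinc (d * t) ^+ 2).
  apply: bounded_measurable_comp sinc2_bounded_measurable; exact: measurable_funM.
wlog c0 : c / 0 <= c => [H|].
  have [/H//|/ltW c0] := lerP 0 c; have := H (- c); rewrite normrN sqrrN.
  rewrite (_ : (fun t => _) = fun t : R => c ^+ 2 * sinc (c * t) ^+ 2).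
    by apply; rewrite oppr_ge0.
  by apply/funext => t; rewrite mulNr /sinc sinN invrN mulrNN.
move: c0; rewrite le_eqVlt => /predU1P[<-|c0].
  rewrite normr0 mul0r (_ : (fun t => _) = fun=> 0); last first.
    by apply/funext => t; rewrite expr0n/= mul0r.
  rewrite oc_integral_cst; last exact: ltW.
  by rewrite !mul0r lexx andbT sub0r oppr_le0 divr_ge0 ?sqr_ge0// ltW.
rewrite gtr0_norm// oc_integralZ// [c ^+ 2]expr2 -[c * c * _]mulrA.
rewrite -sinc2_integral_scale//; last exact: ltW.
have /andP[L U] := sinc2_integral_bounds (mulr_gt0 c0 b0).
apply/andP; split; last by rewrite ler_pM2l.
apply: le_trans (_ : c * (pi / 2 - pi ^+ 2 / (c * b)) <= _); last by rewrite ler_pM2l.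
by rewrite mulrBr (_ : c * (pi ^+ 2 / (c * b)) = pi ^+ 2 / b)//; field; rewrite !gt_eqF.
Qed.

(** The product sin^2 t cos (2 x t) is the combination of sin^2 ((x + 1) t),
    sin^2 ((x - 1) t) and sin^2 (x t) with coefficients 1/2, 1/2 and -1. Divided by t^2,
    each of them falls under [scaled_sinc2_bounds], which gives Fourier inversion for
    the triangle function with an error that is uniform in x. *)
Lemma cos_transform_sinc2 b x : 0 < b ->
  `|cos_transform (fun t => sinc t ^+ 2) b x
    - pi / 2 * (`|x + 1| / 2 + `|x - 1| / 2 - `|x|)| <= pi ^+ 2 / b.
Proof.
move=> b0; pose K (c : R) := oc_integral 0 b (fun t => c ^+ 2 * sinc (c * t) ^+ 2).
have bs (d : R) : bounded_measurable (fun t : R => d ^+ 2 * sinc (d * t) ^+ 2).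
  apply: bounded_measurableZ.
  apply: bounded_measurable_comp sinc2_bounded_measurable; exact: measurable_funM.
have -> : cos_transform (fun t => sinc t ^+ 2) b x =
    2^-1 * K (x + 1) + 2^-1 * K (x - 1) - K x.
  have b1 := bounded_measurableZ 2^-1 (bs (x + 1)).
  have b2 := bounded_measurableZ 2^-1 (bs (x - 1)).
  rewrite /K -!oc_integralZ// -oc_integralD// -oc_integralB//; last exact: bounded_measurableD.
  apply: eq_oc_integral => t /andP[t0 _].
  have cs (c : R) : c ^+ 2 * sinc (c * t) ^+ 2 = sin (c * t) ^+ 2 / t ^+ 2.
    have [->|c0] := eqVneq c 0; first by rewrite mul0r sin0 !expr0n/= !mul0r.
    by rewrite /sinc; field; rewrite c0 gt_eqF.
  rewrite !cs.
  have -> : (x + 1) * t = x * t + t by ring.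
  have -> : (x - 1) * t = x * t - t by ring.
  rewrite sinB sinD.
  have -> : 2 * t * x = x * t + x * t by ring.
  rewrite cosD /sinc expr_div_n; have := cos2Dsin2 t; have := cos2Dsin2 (x * t).
  set C := cos (x * t); set S := sin (x * t); set c := cos t; set s := sin t => H1 H2.
  have -> : C * C - S * S = 1 - 2 * S ^+ 2 by lra.
  have E : s ^+ 2 * (1 - 2 * S ^+ 2) = (S * c) ^+ 2 + (C * s) ^+ 2 - S ^+ 2.
    have H1' : C ^+ 2 = 1 - S ^+ 2 by lra.
    have H2' : c ^+ 2 = 1 - s ^+ 2 by lra.
    by rewrite !exprMn H1' H2'; ring.
  by rewrite mulrAC E; field; rewrite gt_eqF.
have /andP[] := scaled_sinc2_bounds (x + 1) b0.
have /andP[] := scaled_sinc2_bounds (x - 1) b0.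
have /andP[] := scaled_sinc2_bounds x b0.
by rewrite -!/(K _) ler_norml; lra.
Qed.

Lemma sg_integral a b : a <= b -> oc_integral a b (@Num.sg R) = `|b| - `|a|.
Proof.
have pos c d : 0 <= c -> c <= d -> oc_integral c d (@Num.sg R) = d - c.
  move=> c0 cd; rewrite (@eq_oc_integral _ _ (fun=> 1)); last first.
    by move=> t /andP[ct _]; rewrite gtr0_sg// (le_lt_trans c0).
  by rewrite oc_integral_cst// mul1r.
have neg c d : c <= d -> d <= 0 -> oc_integral c d (@Num.sg R) = c - d.
  move=> cd d0; rewrite -(opprK c) -(opprK d) oc_integral_opp; last exact: sg_bounded_measurable.
  rewrite (@eq_oc_integral _ _ (fun=> - 1)); last first.
    by move=> t /andP[ct _]; rewrite sgrN gtr0_sg// (le_lt_trans _ ct)// oppr_ge0.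
  by rewrite oc_integral_cst ?lerN2//; lra.
move=> ab; have [a0|/ltW a0] := lerP 0 a.
  by rewrite pos// !ger0_norm// (le_trans a0).
have [b0|/ltW b0] := lerP 0 b.
  rewrite (@oc_integral_cat _ _ _ 0)//; last exact: sg_bounded_measurable.
  by rewrite neg// pos// ger0_norm// ler0_norm//; lra.
by rewrite neg// !ler0_norm//; lra.
Qed.

(** The triangle function max (0, 1 - |x|), written so that it can be compared with
    [cos_transform_sinc2]. *)
Lemma avg_box x : avg 1 (box 1) x = `|x + 1| / 2 + `|x - 1| / 2 - `|x|.
Proof.
have bsg := @sg_bounded_measurable R.
rewrite avgE//; last exact: box_bounded_measurable.
rewrite invr1 mul1r /box.
under eq_oc_integral do rewrite mulrC.
rewrite oc_integralZ; last first.
  by apply: bounded_measurableB; exact: bounded_measurable_shift.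
rewrite oc_integralB; [|exact: bounded_measurable_shift|exact: bounded_measurable_shift].
rewrite !oc_integral_shift//; [|lra|lra].
rewrite !sg_integral; [|lra|lra].
have -> : x + 1 / 2 + 1 / 2 = x + 1 by lra.
have -> : x - 1 / 2 - 1 / 2 = x - 1 by lra.
have -> : x - 1 / 2 + 1 / 2 = x by lra.
have -> : x + 1 / 2 - 1 / 2 = x by lra.
by lra.
Qed.

Lemma avgs_dist ss f g (e : R) x : all (>%R^~ 0) ss ->
  bounded_measurable f -> bounded_measurable g ->
  (forall y, `|f y - g y| <= e) -> `|avgs ss f x - avgs ss g x| <= e.
Proof.
move=> + bf bg fg; elim: ss x => //= s ss ih x /andP[s0 ss0].
have b h : bounded_measurable h -> bounded_measurable (fun u => avgs ss h (x + s * u)).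
  by move=> bh; apply: bounded_measurable_affine; exact: avgs_bounded_measurable.
rewrite /avg -oc_integralB//; [|exact: b|exact: b].
have -> : e = e * (1 / 2 - - (1 / 2)) by lra.
apply: normr_oc_integral => [||u _]; [|lra|exact: ih].
by apply: bounded_measurableB; exact: b.
Qed.

Lemma avgs_cos_transform n phi b : bounded_measurable phi ->
  avgs (nseq n 1) (cos_transform phi b) = cos_transform (fun t => phi t * sinc t ^+ n) b.
Proof.
move=> bphi; elim: n => [|n ih] /=.
  by congr cos_transform; apply/funext => t; rewrite mulr1.
rewrite ih; apply/funext => x; rewrite avg_cos_transform.
  by congr cos_transform; apply/funext => t; rewrite exprSr mulrA.
apply: bounded_measurableM => //; apply: bounded_measurableX.
exact: sinc_bounded_measurable.
Qed.

(** Apply n further unit averages to the triangle function and to its approximation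
    [cos_transform_sinc2]: they do not increase the uniform distance, and they multiply
    the integrand by sinc^n. *)
Lemma sinc_integral_bspline n b : 0 < b ->
  `|oc_integral 0 b (fun t => sinc t ^+ n.+2) - pi / 2 * avgs (nseq n.+1 1) (box 1) 0|
    <= pi ^+ 2 / b.
Proof.
move=> b0; have pos := @all_nseq1_gt0 R n; have b2 := sinc2_bounded_measurable.
have bbox := @box_bounded_measurable R 1.
have bavg : bounded_measurable (avg 1 (box 1) : R -> R) by exact: avg_bounded_measurable.
have -> : oc_integral 0 b (fun t => sinc t ^+ n.+2) =
    avgs (nseq n 1) (cos_transform (fun t => sinc t ^+ 2) b) 0.
  rewrite avgs_cos_transform//; apply: eq_oc_integral => t _.
  by rewrite mulr0 cos0 mulr1 -exprD.
rewrite -[avgs (nseq n.+1 1) _]/(avg 1 (avgs (nseq n 1) (box 1))) -avgs_avg// -avgsZ//.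
apply: avgs_dist => //.
- by apply: cos_transform_bounded_measurable => //; exact: ltW.
- exact: bounded_measurableZ.
- by move=> y; rewrite avg_box; exact: cos_transform_sinc2.
Qed.

Lemma sinc_integral_avgs n : sinc_integral R n.+2 = avgs (nseq n.+1 1) (box 1) 0.
Proof.
have pi0 := pi_gt0 R; set q := avgs _ _ _.
suff H : (\int[mu]_(t in `[0, b]) (sin t / t) ^+ n.+2) @[b --> +oo] --> pi / 2 * q.
  by rewrite /sinc_integral (cvg_lim _ H)// -(invf_div pi 2) mulKf// gt_eqF// divr_gt0.
apply/cvgrPdist_le => e e0; near=> b.
have b0 : 0 < b by near: b; exact: nbhs_pinfty_gt.
rewrite -Rintegral_itv_obnd_cbnd; last first.
  by apply: bounded_measurable_oc; apply: bounded_measurableX; exact: sinc_bounded_measurable.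
rewrite distrC; apply: le_trans (sinc_integral_bspline n b0) _.
rewrite ler_pdivrMr; last exact: b0.
rewrite mulrC -ler_pdivrMr; last exact: e0.
by near: b; apply: nbhs_pinfty_ge; exact: num_real.
Unshelve. all: by end_near. Qed.

End Sinc.

(** * The lower bound for the largest element *)

Theorem corollary1 (R : realType) (n : nat) (hn : (3 <= n.+1)%N)
    (a : 'I_n.+1 -> int)
    (ha_pos : 0 < a ord0)
    (ha_incr : forall i j : 'I_n.+1, (i < j)%N -> a i < a j)
    (ha_sd : sum_distinct a) :
  sinc_integral R n.+1 * 2 ^+ n < (a ord_max)%:~R.
Proof.
have apos i : 0 < a i.
  have [->//|i0] := eqVneq i ord0; apply: lt_trans ha_pos (ha_incr _ _ _).
  by rewrite lt0n.
pose b i := absz (a i).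
have bE i : (b i)%:Z = a i by rewrite /b gtz0_abs.
have b0 i : (0 < b i)%N by rewrite absz_gt0 gt_eqF.
have bR i : (b i)%:R = (a i)%:~R :> R by rewrite -bE.
have b_sd (I J : {set 'I_n.+1}) : I != J ->
    (\sum_(i in I) b i <> \sum_(j in J) b j)%N.
  have sumE (K : {set 'I_n.+1}) : \sum_(i in K) a i = (\sum_(i in K) b i)%N%:Z.
    by rewrite -natz natr_sum; apply: eq_bigr => i _; rewrite natz.
  by move=> /ha_sd; rewrite !sumE => + IJ; rewrite IJ.
(* The indices other than the last one, whose weight is the width of the box. *)
pose js := [seq widen_ord (leqnSn n) i | i <- enum 'I_n].
have js_max j : j \in js -> (j < @ord_max n)%N.
  by move=> /mapP[i _ ->] /=.
have ujs : uniq (ord_max :: js).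
  rewrite /= map_inj_uniq ?enum_uniq ?andbT; last first.
    by move=> i j /(congr1 val) /= /val_inj.
  by apply/negP => /js_max; rewrite ltnn.
have sjs : size [seq b j | j <- js] = n by rewrite size_map /js size_map size_enum_ord.
have l0 : all (ltn 0) [seq b j | j <- js] by apply/allP => _ /mapP[j _ ->]; exact: b0.
have A0 : 0 < (b ord_max)%:R :> R by rewrite ltr0n.
have := avgs_box_le (R := R) (b0 ord_max) l0 (subset_sums_uniq ujs b_sd).
rewrite sjs ler_pdivlMr ?exprn_gt0// bR; apply: lt_le_trans.
case: n hn => // [[//|n]] _ in
  a ha_incr ha_sd ha_pos apos b bE b0 bR b_sd js js_max ujs sjs l0 A0 *.
rewrite ltr_pM2r ?exprn_gt0// sinc_integral_avgs.
set ss := [seq s / _ | s <- _].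
have sss : size ss = n.+2 by rewrite size_map size_map sjs.
rewrite -sss; apply: avgs_gt_nseq1.
- by rewrite sss.
- apply/allP => _ /mapP[_ /mapP[_ /mapP[j jjs ->] ->] ->] /=.
  by rewrite divr_gt0 -?bR// ltr0n.
- apply/allP => _ /mapP[_ /mapP[_ /mapP[j jjs ->] ->] ->] /=.
  by rewrite ltr_pdivrMr -?bR// mul1r ltr_nat -ltz_nat !bE ha_incr// js_max.
- exact: box_bounded_measurable.
- exact: box1_unimodal.
- exact: box1_peaked.
Qed.
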